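(* For zero-dimensional locally compact paracompact spaces $X$ and $Y$ the following conditions are equivalent. (1) $\mathcal T^*_K(X)$ and $\mathcal T^*_K(Y)$ are order-isomorphic; (2) $\sigma X\setminus X$ and $\sigma Y\setminus Y$ are homeomorphic.
   Context: Compact, locally compact and paracompact spaces are assumed Hausdorff. A space is zero-dimensional if its clopen subsets form an open base. For a Tychonoff space $X$, a one-point extension of $X$ is a Tychonoff space $T$ containing $X$ as a dense subspace such that $T\setminus X$ is a singleton; we write $T=X\cup\{p\}$. Two extensions are identified if there is a homeomorphism between them fixing $X$ pointwise. For extensions $T_1,T_2$ of $X$, $T_2\leq T_1$ means there is a continuous $f:T_1\to T_2$ fixing $X$ pointwise; this is a partial order on the set $\mathcal T(X)$ of all (equivalence classes of) one-point extensions of $X$. $\mathcal T^*_K(X)$ is the set (with the induced order) of all $T=X\cup\{p\}\in\mathcal T(X)$ such that $T$ is locally compact and first countable at $p$. $\beta X$ is the Stone-Čech compactification of $X$ and $\sigma X=\bigcup\{\mathrm{cl}_{\beta X}A: A\subseteq X\text{ is }\sigma\text{-compact}\}$. Partially ordered sets are order-isomorphic if there is a bijection between them that is order-preserving with order-preserving inverse. *)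

(* Defs.v *)
From HB Require Import structures.
From mathcomp Require Import all_boot all_order all_algebra.
From mathcomp Require Import all_classical all_reals all_analysis.

Set Implicit Arguments.
Unset Strict Implicit.
Unset Printing Implicit Defensive.

Import Order.TTheory GRing.Theory Num.Theory.
Import numFieldNormedType.Exports.

Local Open Scope classical_set_scope.
Local Open Scope ring_scope.

Definition homeomorphic (S T : topologicalType) : Prop :=
  exists (f : S -> T) (g : T -> S),
    [/\ continuous f, continuous g, cancel f g & cancel g f].

Definition topological_embedding (S T : topologicalType) (f : S -> T) : Prop :=
  injective f /\
  forall A : set S, open A <-> exists2 B : set T, open B & f @^-1` B = A.

Definition tychonoff_space (T : topologicalType) : Prop :=
  hausdorff_space T /\ completely_regular_space T.

Definition locally_compact_hausdorff (T : topologicalType) : Prop :=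
  hausdorff_space T /\ locally_compact [set: T].

Definition locally_finite (T : topologicalType) (V : set (set T)) : Prop :=
  forall x : T, exists2 N : set T, nbhs x N &
    finite_set [set W | V W /\ W `&` N !=set0].

Definition paracompact_hausdorff (T : topologicalType) : Prop :=
  hausdorff_space T /\
  forall U : set (set T),
    U `<=` open -> \bigcup_(W in U) W = [set: T] ->
    exists V : set (set T),
      [/\ V `<=` open, \bigcup_(W in V) W = [set: T],
          forall W, V W -> exists2 W', U W' & W `<=` W'
        & locally_finite V].

(* This is strictly stronger than the library's [zero_dimensional], which only
   asks that distinct points be separated by clopen sets. *)
Definition has_clopen_base (T : topologicalType) : Prop :=
  basis [set U : set T | clopen U].

Definition first_countable_at (T : topologicalType) (p : T) : Prop :=
  exists B : set (set T),
    [/\ countable B, forall U, B U -> open_nbhs p U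
      & forall N, nbhs p N -> exists2 U, B U & U `<=` N].

Definition sigma_compact (T : topologicalType) (A : set T) : Prop :=
  exists K : nat -> set T, (forall n, compact (K n)) /\ A = \bigcup_n K n.

Section one_point_extensions.
Variable X : topologicalType.

Record one_point_extension := OnePointExtension {
  ope_space :> topologicalType;
  ope_incl : X -> ope_space;
  ope_point : ope_space;
  ope_tychonoff : tychonoff_space ope_space;
  ope_embedding : topological_embedding ope_incl;
  ope_dense : dense (range ope_incl);
  ope_remainder : ~` range ope_incl = [set ope_point] }.

Definition ope_le (T2 T1 : one_point_extension) : Prop :=
  exists f : T1 -> T2,
    continuous f /\ forall x, f (ope_incl T1 x) = ope_incl T2 x.

Definition ope_equiv (T1 T2 : one_point_extension) : Prop :=
  exists (f : T1 -> T2) (g : T2 -> T1),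
    [/\ continuous f, continuous g, cancel f g, cancel g f
      & forall x, f (ope_incl T1 x) = ope_incl T2 x].

(* A predicate rather than a [set], for universe reasons: [set] does not apply
   to types that quantify over all topological spaces. *)
Definition ope_class (T : one_point_extension) : one_point_extension -> Prop :=
  ope_equiv T.

Definition in_TK (T : one_point_extension) : Prop :=
  locally_compact_hausdorff T /\ first_countable_at (ope_point T).

(* The poset T*_K(X): equivalence classes of extensions in T*_K. *)
Definition TK : Type :=
  {C : one_point_extension -> Prop | exists2 T, in_TK T & C = ope_class T}.

Definition TK_le (C2 C1 : TK) : Prop :=
  exists T2 T1, [/\ sval C2 T2, sval C1 T1 & ope_le T2 T1].

End one_point_extensions.

Definition order_isomorphic (P Q : Type) (leP : P -> P -> Prop)
    (leQ : Q -> Q -> Prop) : Prop :=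
  exists (f : P -> Q) (g : Q -> P),
    [/\ cancel f g, cancel g f,
        forall x y, leP x y -> leQ (f x) (f y)
      & forall x y, leQ x y -> leP (g x) (g y)].

(* The Stone-Cech compactification of a Tychonoff space X, as the closure of
   the image of X under evaluation in the cube [0, 1] ^ C(X, [0, 1]); that cube
   is closed in R ^ C(X, [0, 1]), where the closure is taken. *)
Section stone_cech_compactification.
Variables (R : realType) (X : topologicalType).

Definition unit_functions : set (X -> R) :=
  [set f : X -> R | continuous f /\ forall x, 0 <= f x <= 1].

Definition evaluation_space : topologicalType :=
  prod_topology (fun _ : unit_functions => R).

Definition evaluation (x : X) : evaluation_space := fun f => set_val f x.

Definition stone_cech : topologicalType := closure (range evaluation).

Lemma evaluation_in_closure (x : X) :
  evaluation x \in closure (range evaluation).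
Proof. by rewrite inE; apply: subset_closure; exists x. Qed.

Definition to_stone_cech (x : X) : stone_cech :=
  exist _ (evaluation x) (evaluation_in_closure x).

Definition sigma_extension : set stone_cech :=
  \bigcup_(A in [set A : set X | sigma_compact A]) closure (to_stone_cech @` A).

Definition sigma_remainder : topologicalType :=
  sigma_extension `\` range to_stone_cech.

End stone_cech_compactification.

(* Main.v *)
Require Import Defs.
From HB Require Import structures.
From mathcomp Require Import all_boot all_order all_algebra.
From mathcomp Require Import all_classical all_reals all_analysis.

Set Implicit Arguments.
Unset Strict Implicit.
Unset Printing Implicit Defensive.

Import Order.TTheory GRing.Theory Num.Theory.
Import numFieldNormedType.Exports.

Local Open Scope classical_set_scope.
Local Open Scope ring_scope.

(** Why the theorem holds.  Both sides are governed by the same combinatorial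
    object: the clopen sigma-compact subsets [A] of [X], compared by
    [compact (A `\` B)], with the compact ones discarded.

    An extension [T] with added point [p] that is locally compact has, since
    [X] is zero-dimensional, a compact open neighbourhood [K] of [p]; its trace
    [A] on [X] is clopen, and [T] is near [p] the one-point compactification of
    [A].  First countability at [p] says exactly that [A] is sigma-compact, and
    density of [X] that [A] is not compact.  Conversely every such [A] can be
    closed up by one point.  A map [T1 -> T2] over [X] exists if and only if
    [A1 `\` A2] is compact ([ope_leP]), so the order of extensions is the
    reversed order of traces, up to compact sets.

    On the other side, a clopen [A] has a clopen closure in [beta X], and when
    [A] is sigma-compact that closure cuts a compact open set out of
    [sigma X \ X]; it is empty if and only if [A] is compact, and inclusion of
    these sets is again [compact (A `\` B)] ([remainder_trace_sub]).  Every
    compact open subset arises so ([compact_open_remainder_trace]).  Two facts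
    are behind this: paracompactness puts every sigma-compact set inside a
    clopen sigma-compact one, and a sigma-compact zero-dimensional space is
    Lindelof, so that two open sets covering it can be shrunk to complementary
    clopen sets.

    Hence the poset of extensions is anti-isomorphic to the poset of nonempty
    compact open subsets of [sigma X \ X] ([TK_dual]).  The latter space is
    Hausdorff with a base of compact open sets, and Stone duality for such
    spaces recovers it from that poset ([stone_duality]). *)

(** * Compact and clopen sets *)

(** The form in which compactness is used throughout: the members of [G] are
    usually traces, images or closures of clopen sets, and a finite union of
    such sets is again one, so that a single member can be extracted. *)
Lemma compact_directed_cover (T : topologicalType) (K : set T)
    (G : set (set T)) :
  compact K -> G set0 -> setU_closed G -> G `<=` open ->
  K `<=` \bigcup_(U in G) U -> exists2 U, G U & K `<=` U.
Proof.
move=> cK G0 GU Go KG; apply: contrapT => nK.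
pose F := [set S : set T | exists2 U, G U & K `\` U `<=` S].
have FF : ProperFilter F.
  apply: Build_ProperFilter_ex.
    move=> S [U GU' KS]; apply: contrapT => /forallNP nS; apply: nK.
    exists U => // x Kx; apply: contrapT => nUx; exact: (nS x (KS x _)).
  split.
  - by exists set0.
  - move=> P Q [U GU1 UP] [V GV VQ]; exists (U `|` V); first exact: GU.
    by move=> x [Kx /not_orP[nU nV]]; split; [exact: UP | exact: VQ].
  - by move=> P Q PQ [U GU1 UP]; exists U => // x /UP /PQ.
have FK : F K by exists set0 => // x [].
have [x [Kx clx]] := cK F FF FK.
have [U GU1 Ux] := KG _ Kx.
have FKU : F (K `\` U) by exists U.
have nU : nbhs x U by apply: open_nbhs_nbhs; split=> //; exact: Go.
by have [y [[_ nUy] Uy]] := clx _ _ FKU nU.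
Qed.

Lemma compact_embedding_preimage (S T : topologicalType) (f : S -> T)
    (K : set T) :
  topological_embedding f -> compact K -> K `<=` range f ->
  compact (f @^-1` K).
Proof.
move=> [injf emb] cK Kr F FF FK.
have [t [Kt clt]] := cK (f @ F) _ FK.
have [x _ fx] := Kr _ Kt; exists x; split; first by rewrite /= fx.
move=> U N FU; rewrite nbhsE => -[B0 [oB0 B0x] B0N].
have [B oB BO] := (emb B0).1 oB0.
have FfU : (f @ F) (f @` U) by apply: (@filterS _ F _ U) => // y Uy; exists y.
have nB : nbhs t B.
  by apply: open_nbhs_nbhs; split=> //; rewrite -fx -[B _]/((f @^-1` B) x) BO.
have [_ [[u Uu <-] Bu]] := clt _ _ FfU nB.
by exists u; split=> //; apply: B0N; rewrite -BO.
Qed.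

Lemma compact_continuous_image (S T : topologicalType) (f : S -> T)
    (K : set S) :
  continuous f -> compact K -> compact (f @` K).
Proof. by move=> cf; apply: continuous_compact; exact: continuous_subspaceT. Qed.

Lemma compact_setD (T : topologicalType) (K U : set T) :
  compact K -> open U -> compact (K `\` U).
Proof.
by move=> cK oU; rewrite setDE; apply: compact_closedI => //; exact: open_closedC.
Qed.

Lemma open_setD (T : topologicalType) (U K : set T) :
  open U -> closed K -> open (U `\` K).
Proof.
by move=> oU cK; rewrite setDE; apply: openI => //; exact: closed_openC.
Qed.

Lemma clopen_setD (T : topologicalType) (A B : set T) :
  clopen A -> clopen B -> clopen (A `\` B).
Proof. by move=> cA cB; rewrite setDE; apply: clopenI => //; exact: clopenC. Qed.

Lemma clopen_summand (T : topologicalType) (A B C : set T) :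
  clopen A -> open B -> open C -> B `&` C = set0 -> B `|` C = A -> clopen B.
Proof.
move=> clA oB oC BC0 BCA; split=> //; rewrite (_ : B = ~` (~` A `|` C)).
  by apply: open_closedC; apply: openU => //; exact: (clopenC _ clA).1.
rewrite setCU setCK -BCA; apply/seteqP; split=> x.
  by move=> Bx; split; [left | move=> Cx; rewrite -[False]/(set0 x) -BC0].
by case=> -[].
Qed.

Lemma locally_compact_nbhs (T : topologicalType) (x : T) :
  locally_compact [set: T] -> exists2 U, nbhs x U & compact U.
Proof.
move=> /(_ x I)[U wU [cU _]]; exists U => //.
by apply: (@filterS _ (nbhs x) _ [set y | [set: T] y -> U y]) wU => y; apply.
Qed.

Lemma sigma_compact_bigcup (T : topologicalType) (F : nat -> set T) :
  (forall n, sigma_compact (F n)) -> sigma_compact (\bigcup_n F n).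
Proof.
move=> sF; have [K HK] := choice sF.
pose L m := if unpickle m is Some (i, j) then K i j else set0.
exists L; split=> [m|].
  rewrite /L; case: unpickle => [[i j]|]; last exact: compact0.
  by have [cK _] := HK i; exact: cK.
apply/seteqP; split=> x.
  move=> [i _]; have [_ ->] := HK i => -[j _ Kx].
  by exists (pickle (i, j)) => //; rewrite /L pickleK.
move=> [m _]; rewrite /L; case: unpickle => [[i j]|] //= Kx.
by exists i => //; have [_ ->] := HK i; exists j.
Qed.

Lemma sigma_compact_closedI (T : topologicalType) (A B : set T) :
  sigma_compact A -> closed B -> sigma_compact (A `&` B).
Proof.
move=> [K [cK ->]] cB; exists (fun n => K n `&` B); split.
  by move=> n; exact: compact_closedI.
by rewrite setI_bigcupl.
Qed.

Lemma compact_sigma_compact (T : topologicalType) (K : set T) :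
  compact K -> sigma_compact K.
Proof. by move=> cK; exists (fun=> K); split=> //; rewrite bigcup_const. Qed.

Lemma sigma_compactU (T : topologicalType) (A B : set T) :
  sigma_compact A -> sigma_compact B -> sigma_compact (A `|` B).
Proof.
move=> sA sB.
have -> : A `|` B = \bigcup_n (if n is 0%N then A else B).
  apply/seteqP; split=> x.
    by case=> ?; [exists 0%N | exists 1%N].
  by case=> -[|n] _ ?; [left | right].
by apply: sigma_compact_bigcup => -[|n].
Qed.

Section zero_dimensional.
Variable X : topologicalType.
Hypothesis X_zd : has_clopen_base X.

Lemma clopen_nbhs_base (x : X) (N : set X) :
  nbhs x N -> exists D, [/\ clopen D, D x & D `<=` N].
Proof. by move=> nN; have [_ /(_ x N nN) [D [cD Dx] DN]] := X_zd; exists D. Qed.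

Hypothesis X_lc : locally_compact_hausdorff X.

Lemma compact_clopen_nbhs_base (x : X) (N : set X) : nbhs x N ->
  exists D, [/\ clopen D, compact D, D x & D `<=` N].
Proof.
move=> nN; have [U nU cU] := locally_compact_nbhs x X_lc.2.
have [D [cD Dx DUN]] := clopen_nbhs_base (filterI nN nU).
exists D; split=> //; last by move=> y /DUN[].
by apply: (subclosed_compact cD.2 cU) => y /DUN[].
Qed.

Lemma compact_clopen_cover (x : X) : exists D, [/\ clopen D, compact D & D x].
Proof.
have [D [clD cD Dx _]] := compact_clopen_nbhs_base (@filterT _ (nbhs x) _).
by exists D.
Qed.

Lemma compact_sub_compact_clopen (K : set X) : compact K ->
  exists D, [/\ clopen D, compact D & K `<=` D].
Proof.
move=> cK.
have [|U V [clU cU] [clV cV]|D [[]]|x Kx|D [clD cD] KD] :=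
    @compact_directed_cover X K [set D | clopen D /\ compact D] cK.
- by split; [exact: clopen0 | exact: compact0].
- by split; [exact: clopenU | exact: compactU].
- by [].
- by have [D [clD cD Dx]] := compact_clopen_cover x; exists D.
by exists D.
Qed.

(** A sigma-compact set is Lindelof, so countably many clopen sets [E n], each
    the union of a clopen part of [P] and a clopen part of [Q], cover [A].
    Making the parts pairwise disjoint in the order of [n] gives [B] and [C];
    both are open, hence each is closed as the complement of the other. *)
Lemma sigma_compact_clopen_split (A P Q : set X) :
  sigma_compact A -> clopen A -> open P -> open Q -> A `<=` P `|` Q ->
  exists B C, [/\ clopen B, clopen C, B `|` C = A, B `<=` P & C `<=` Q].
Proof.
move=> [K [cK AE]] clA oP oQ APQ.
pose ok (BC : set X * set X) :=
  [/\ clopen BC.1, clopen BC.2, BC.1 `<=` P & BC.2 `<=` Q].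
have cover n : exists BC, ok BC /\ K n `<=` BC.1 `|` BC.2.
  have [|U V||x Kx|W [BC okBC <-] KW] :=
    @compact_directed_cover X (K n)
      [set W | exists2 BC, ok BC & BC.1 `|` BC.2 = W] (cK n).
  - exists (set0, set0); last by rewrite /= setU0.
    by split=> //=; exact: clopen0.
  - move=> [[B1 C1] [/= ? ? ? ?] <-] [[B2 C2] [/= ? ? ? ?] <-].
    exists (B1 `|` B2, C1 `|` C2); last by rewrite /= setUACA.
    by split=> /=; [exact: clopenU | exact: clopenU| |]; rewrite subUset.
  - by move=> W [BC [[oB _] [oC _] _ _] <-]; exact: openU.
  - have : A x by rewrite AE; exists n.
    move=> /APQ [Px|Qx].
      have [D [clD Dx DP]] := clopen_nbhs_base (open_nbhs_nbhs (conj oP Px)).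
      exists D => //; exists (D, set0); last by rewrite /= setU0.
      by split=> //=; exact: clopen0.
    have [D [clD Dx DP]] := clopen_nbhs_base (open_nbhs_nbhs (conj oQ Qx)).
    exists D => //; exists (set0, D); last by rewrite /= set0U.
    by split=> //=; exact: clopen0.
  by exists BC.
have [E HE] := choice cover.
(* A point is sorted by the first [n] that catches it, and within that [n]
   into [P] rather than [Q] if possible. *)
pose prev n := \big[setU/set0]_(k < n) ((E k).1 `|` (E k).2).
have clprev n : clopen (prev n).
  rewrite /prev; elim/big_ind: _ => [||k _]; [exact: clopen0|exact: clopenU|].
  by have [[clB clC _ _] _] := HE k; exact: clopenU.
pose B := \bigcup_n (A `&` ((E n).1 `\` prev n)).
pose C := \bigcup_n (A `&` (((E n).2 `\` (E n).1) `\` prev n)).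
have oB : open B.
  apply: bigcup_open => n _; apply: openI; first exact: clA.1.
  by have [[clB clC _ _] _] := HE n; exact: (clopen_setD clB (clprev n)).1.
have oC : open C.
  apply: bigcup_open => n _; apply: openI; first exact: clA.1.
  have [[clB clC _ _] _] := HE n.
  exact: (clopen_setD (clopen_setD clC clB) (clprev n)).1.
have prevP n x : prev n x <-> exists2 k, (k < n)%N & ((E k).1 `|` (E k).2) x.
  rewrite /prev -(bigcup_mkord n (fun k => (E k).1 `|` (E k).2)).
  by split=> -[k kn Ex]; exists k.
have BC0 : B `&` C = set0.
  rewrite -subset0 => x [[n _ [_ [En nprev]]] [m _ [_ [[Em nEm] mprev]]]].
  have [nm|mn|nm] := ltngtP n m.
  - by apply: mprev; apply/prevP; exists n => //; left.
  - by apply: nprev; apply/prevP; exists m => //; right.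
  - by apply: nEm; rewrite -nm.
have BCA : B `|` C = A.
  apply/seteqP; split=> x; first by case=> -[n _ []].
  move=> Ax; have : exists n, `[< ((E n).1 `|` (E n).2) x >].
    move: (Ax); rewrite {1}AE => -[n _ Kx]; exists n; apply/asboolP.
    by have [_] := HE n; apply.
  move=> /ex_minnP[n /asboolP En nmin].
  have npr : ~ prev n x.
    by move=> /prevP[k kn /asboolP /nmin]; rewrite leqNgt kn.
  have [E1|E1] := pselect ((E n).1 x); first by left; exists n.
  by right; exists n => //; split=> //; split=> //; split=> //; case: En.
exists B, C; split=> //.
- exact: clopen_summand clA oB oC BC0 BCA.
- by apply: (clopen_summand clA oC oB); rewrite 1?setIC 1?setUC.
- by move=> x [n _ [_ [Ex _]]]; have [[_ _ h _] _] := HE n; exact: h.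
- by move=> x [n _ [_ [[Ex _] _]]]; have [[_ _ _ h] _] := HE n; exact: h.
Qed.

(** Take a locally finite open cover [V] by relatively compact sets.  The star
    of a relatively compact set is relatively compact, as only finitely many
    members of [V] meet a compact set.  So the union of all iterated stars of
    the pieces of [K] is sigma-compact; being stable under stars, it is open
    and closed. *)
Lemma sigma_compact_sub_clopen (K : set X) : paracompact_hausdorff X ->
  sigma_compact K ->
  exists A, [/\ clopen A, sigma_compact A & K `<=` A].
Proof.
move=> [_ X_pc] [K0 [cK0 KE]].
have [||V [oV covV refV lfV]] := X_pc [set D | clopen D /\ compact D].
- by move=> D [[]].
- rewrite -subTset => x _.
  by have [D [clD cD Dx]] := compact_clopen_cover x; exists D.
pose star S := \bigcup_(W in [set W | V W /\ W `&` S !=set0]) W.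
have sub_star S : S `<=` star S.
  move=> x Sx; have : [set: X] x by [].
  by rewrite -covV => -[W VW Wx]; exists W => //; split=> //; exists x.
have star_compact S : (exists2 L, compact L & S `<=` L) ->
    exists2 L, compact L & star S `<=` L.
  move=> [L cL SL].
  pose G := [set O : set X | open O /\
    exists2 M, compact M & forall W, V W -> W `&` O !=set0 -> W `<=` M].
  have [|U U' [oU [M cM HM]] [oU' [M' cM' HM']]|O []|x Lx|O [oO [M cM HM]] LO] :=
    @compact_directed_cover X L G cL.
  - split; first exact: open0.
    by exists set0; [exact: compact0 | move=> W _ [y []]].
  - split; first exact: openU.
    exists (M `|` M'); first exact: compactU.
    move=> W VW [y [Wy [Uy|Uy]]] z Wz.
      by left; apply: (HM _ VW) => //; exists y.
    by right; apply: (HM' _ VW) => //; exists y.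
  - by [].
  - have [N nN finN] := lfV x.
    exists N° => //; split; first exact: open_interior.
    pose WN := [set W | V W /\ W `&` N !=set0].
    have bnd W : exists D, compact D /\ (V W -> W `<=` D).
      have [VW|nVW] := pselect (V W); last first.
        by exists set0; split=> //; exact: compact0.
      by have [D [_ cD] WD] := refV _ VW; exists D.
    have [D HD] := choice bnd.
    exists (\bigcup_(W in WN) D W).
      rewrite -bigsetU_fset_set//; apply: bigsetU_compact => W _.
      by have [] := HD W.
    move=> W VW [y [Wy Ny]] z Wz; exists W; last by have [_] := HD W; apply.
    by split=> //; exists y; split=> //; exact: interior_subset.
  exists M => // x [W [VW [y [Wy Sy]]] Wx]; apply: (HM W VW _ x Wx).
  by exists y; split=> //; apply: LO; exact: SL.
have open_star S : open (star S) by apply: bigcup_open => W [/oV].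
pose A := \bigcup_m \bigcup_n iter n star (K0 m).
have cpt_iter m n : exists2 L, compact L & iter n star (K0 m) `<=` L.
  by elim: n => [|n IH] /=; [exists (K0 m) | exact: star_compact].
have oA : open A.
  rewrite (_ : A = \bigcup_m \bigcup_n iter n.+1 star (K0 m)).
    by apply: bigcup_open => m _; apply: bigcup_open => n _; exact: open_star.
  apply/seteqP; split=> x [m _ [n _ xn]]; exists m => //.
    by exists n => //=; exact: sub_star.
  by exists n.+1.
have clA : closed A.
  rewrite -openC openE => x nAx.
  have : [set: X] x by [].
  rewrite -covV => -[W VW Wx]; apply: (@filterS _ _ _ W).
    move=> y Wy [m _ [n _ yn]]; apply: nAx; exists m => //; exists n.+1 => //=.
    by exists W => //; split=> //; exists y.
  by apply: open_nbhs_nbhs; split=> //; exact: oV.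
exists A; split=> //; last first.
  by rewrite KE => x [m _ Kx]; exists m => //; exists 0%N.
have /choice[L HL] (mn : nat * nat) :
    exists L, compact L /\ iter mn.2 star (K0 mn.1) `<=` L.
  by have [L cL sL] := cpt_iter mn.1 mn.2; exists L.
rewrite (_ : A = (\bigcup_m \bigcup_n L (m, n)) `&` A).
  apply: sigma_compact_closedI => //; apply: sigma_compact_bigcup => m.
  apply: sigma_compact_bigcup => n; apply: compact_sigma_compact.
  by have [] := HL (m, n).
apply/seteqP; split=> x; last by case.
move=> Ax; split=> //; case: Ax => m _ [n _ xn]; exists m => //; exists n => //.
by have [_] := HL (m, n); apply.
Qed.

End zero_dimensional.

(** * Closures of clopen sets in the Stone-Cech compactification *)

Lemma set_val_embedding (T : topologicalType) (A : set T) :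
  topological_embedding (set_val : A -> T).
Proof.
split; first by move=> x y; rewrite set_valE; exact: val_inj.
by move=> U; split=> -[B oB BU]; exists B.
Qed.

Lemma hausdorff_embedding (S T : topologicalType) (f : S -> T) :
  topological_embedding f -> hausdorff_space T -> hausdorff_space S.
Proof.
move=> [injf emb]; rewrite !open_hausdorff => hT x y xy.
have /hT[[A B] [/= xA yB] [oA oB AB0]] : f x != f y.
  by apply: contra_neq xy; exact: injf.
exists (f @^-1` A, f @^-1` B); first by rewrite !inE in xA yB *.
split; [by apply/emb; exists A | by apply/emb; exists B |].
by move/eqP: AB0 => AB0; rewrite -preimage_setI /= AB0 preimage_set0.
Qed.

Lemma cvg_initial (S : choiceType) (T : topologicalType) (f : S -> T)
    (F : set_system S) (s : initial_topology f) :
  Filter F -> f @ F --> f s -> F --> s.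
Proof.
move=> FF Ffs N [_ [[B oB <-] Bfs] BN].
by apply: (@filterS _ F _ _ _ BN); apply: Ffs; exact: open_nbhs_nbhs.
Qed.

Section stone_cech_facts.
Variables (R : realType) (X : topologicalType).

Notation bX := (stone_cech R X).
Notation e := (@to_stone_cech R X).

(** The continuous extension of [g] to the compactification. *)
Definition coordinate (g : @unit_functions R X) (z : bX) : R := set_val z g.

Lemma coordinate_continuous (g : @unit_functions R X) : continuous (coordinate g).
Proof.
move=> z; apply: (@continuous_comp _ (evaluation_space R X) _ set_val (proj g)).
  exact: initial_continuous.
exact: proj_continuous.
Qed.

(** The topology of the compactification is initial for the coordinates. *)
Lemma cvg_stone_cech (F : set_system bX) (z : bX) : Filter F ->
  (forall g, coordinate g @ F --> coordinate g z) -> F --> z.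
Proof.
move=> FF Fz.
have FzE : set_val @ F --> (set_val z : evaluation_space R X).
  by apply/cvg_sup => g; apply: cvg_initial; exact: Fz.
exact: (@cvg_initial _ _ set_val F z).
Qed.

Lemma to_stone_cech_continuous : continuous e.
Proof.
move=> x; apply: cvg_stone_cech => g.
have [cg _] := set_valP g.
exact: (cg x).
Qed.

Lemma dense_to_stone_cech : dense (range e).
Proof.
move=> U [z Uz] [B oB BU].
have Bz : B (set_val z) by rewrite -[B _]/((set_val @^-1` B) z) BU.
have /(_ _ (open_nbhs_nbhs (conj oB Bz)))[_ [[x _ <-] Bx]] := set_valP z.
by exists (e x); split; [rewrite -BU | exists x].
Qed.

Lemma stone_cech_hausdorff : hausdorff_space bX.
Proof.
apply: (hausdorff_embedding (@set_val_embedding (evaluation_space R X) _)).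
by apply: hausdorff_product => g; exact: Rhausdorff.
Qed.

Lemma stone_cech_compact : compact [set: bX].
Proof.
have cube : compact [set f : evaluation_space R X | forall g, `[0, 1]%classic (f g)].
  apply: (@tychonoff (@unit_functions R X) (fun=> R) (fun=> `[0, 1]%classic)) => g.
  exact: segment_compact.
have sub : closure (range (@evaluation R X)) `<=`
    [set f : evaluation_space R X | forall g, `[0, 1]%classic (f g)].
  rewrite [X in _ `<=` X](closure_id _).1; last first.
    by apply: compact_closed cube; apply: hausdorff_product => g; exact: Rhausdorff.
  apply: closureS => _ [x _ <-] g /=; rewrite in_itv /=.
  by have [_] := set_valP g; apply.
rewrite (_ : setT = set_val @^-1` (closure (range (@evaluation R X)))); last first.
  by apply/seteqP; split=> z // _; exact: set_valP.
apply: compact_embedding_preimage; first exact: set_val_embedding.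
  exact: (subclosed_compact (@closed_closure _ _) cube sub).
by move=> f /mem_set ff; exists (SigSub ff).
Qed.

Notation cl D := (closure (e @` D)).

Lemma indic_unit_function (D : set X) : clopen D -> @unit_functions R X \1_D.
Proof.
move=> [oD cD]; split; last first.
  by move=> x; rewrite indicE; case: (x \in D); rewrite ?lexx ?ler01.
move=> x; apply: cvg_near_cst.
have [Dx|Dx] := pselect (D x).
  by near=> y; rewrite !indicE !mem_set//; near: y; exact: open_nbhs_nbhs.
near=> y; rewrite !indicE !memNset//; near: y.
by apply: open_nbhs_nbhs; split=> //; exact: closed_openC.
Unshelve. all: by end_near. Qed.

Lemma indic_coordinate (D : set X) : clopen D -> exists h : bX -> R,
  [/\ continuous h, forall x, D x -> h (e x) = 1 & forall x, ~ D x -> h (e x) = 0].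
Proof.
move=> cD; exists (coordinate (SigSub (mem_set (indic_unit_function cD)))).
split; first exact: coordinate_continuous.
  by move=> x Dx; rewrite -[LHS]/(\1_D x : R) indicE mem_set.
by move=> x Dx; rewrite -[LHS]/(\1_D x : R) indicE memNset.
Qed.

(** The extension of the indicator function of [D] is 1 on the closure of [D]
    and 0 on the closure of any set disjoint from [D]. *)
Lemma disjoint_closures (D D' : set X) : clopen D -> D `&` D' = set0 ->
  cl D `&` cl D' = set0.
Proof.
move=> cD DD'; have [h [ch h1 h0]] := indic_coordinate cD.
have cl1 r : closed (h @^-1` [set r]).
  by apply: preimage_closed => // x _; exact: ch.
rewrite -subset0 => z [zD zD'].
have hz1 : h z = 1.
  apply: (cl1 1 z); move: z zD {zD'}; apply: closureS => _ [x Dx <-]; exact: h1.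
have hz0 : h z = 0.
  apply: (cl1 0 z); move: z zD' {zD hz1}; apply: closureS => _ [x Dx <-].
  by apply: h0 => D1x; rewrite -[False]/(set0 x) -DD'.
by move/eqP: hz1; rewrite hz0 eq_sym oner_eq0.
Qed.

Lemma closure_image_setU (D D' : set X) : cl (D `|` D') = cl D `|` cl D'.
Proof. by rewrite image_setU closureU. Qed.

(** With [closure_image_setU], this makes the closure a homomorphism of Boolean
    algebras from the clopen subsets of [X] to those of [beta X]. *)
Lemma closure_image_setC (D : set X) : clopen D -> cl (~` D) = ~` cl D.
Proof.
move=> clD; apply/seteqP; split=> z.
  move=> zD' zD; rewrite -[False]/(set0 z).
  by rewrite -(disjoint_closures clD (setICr D)).
have : (cl D `|` cl (~` D)) z.
  rewrite -closure_image_setU setUv => N nN.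
  have [|y [Ny ry]] := dense_to_stone_cech _ (open_interior N).
    by exists z.
  by exists y; split=> //; exact: interior_subset.
by case.
Qed.

Lemma clopen_closure_image (D : set X) : clopen D -> clopen (cl D).
Proof.
move=> clD; split; last exact: closed_closure.
rewrite -[D]setCK closure_image_setC; last exact: clopenC.
by apply: closed_openC; exact: closed_closure.
Qed.

Lemma closure_imageE (D : set X) (x : X) : clopen D -> cl D (e x) -> D x.
Proof.
move=> clD Dx; apply: contrapT => nDx.
have : cl (~` D) (e x) by apply: subset_closure; exists x.
by rewrite closure_image_setC.
Qed.

Lemma closure_image_setD (D D' : set X) : clopen D -> clopen D' ->
  cl (D `\` D') = cl D `\` cl D'.
Proof.
move=> clD clD'; rewrite -[LHS]setCK -closure_image_setC; last exact: clopen_setD.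
by rewrite setDE setCI setCK closure_image_setU closure_image_setC// setDE setCU setCK.
Qed.

Lemma closure_image_setI (D D' : set X) : clopen D -> clopen D' ->
  cl (D `&` D') = cl D `&` cl D'.
Proof.
move=> clD clD'; rewrite -[D']setCK -setDE closure_image_setD//; last exact: clopenC.
by rewrite closure_image_setC// !setDE !setCK.
Qed.

Lemma closure_image_compact (D : set X) : compact D -> cl D = e @` D.
Proof.
move=> cD; apply/esym/(closure_id _).1; apply: compact_closed.
  exact: stone_cech_hausdorff.
exact: compact_continuous_image to_stone_cech_continuous cD.
Qed.

Hypothesis X_zd : has_clopen_base X.
Hypothesis X_lc : locally_compact_hausdorff X.

Lemma open_range_to_stone_cech : open (range e).
Proof.
rewrite openE => _ [x _ <-].
have [D [clD cD Dx]] := compact_clopen_cover X_zd X_lc x.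
apply: (@filterS _ _ _ (cl D)); last first.
  apply: open_nbhs_nbhs; split; first exact: (clopen_closure_image clD).1.
  by apply: subset_closure; exists x.
by rewrite closure_image_compact// => _ [y _ <-]; exists y.
Qed.

(** If the closure of [D] adds no point, it is a compact subset of [X] covered
    by the open sets [cl D'] with [D'] compact clopen, so it lies in one of
    them. *)
Lemma compact_closure_imageP (D : set X) : clopen D ->
  cl D `<=` range e <-> compact D.
Proof.
move=> clD; split=> [Dr|cD]; last first.
  by rewrite closure_image_compact// => _ [y _ <-]; exists y.
have cclD : compact (cl D).
  by apply: (subclosed_compact (@closed_closure _ _) stone_cech_compact).
have [|U V [D1 [? ?] <-] [D2 [? ?] <-]|U [D1 [clD1 _] <-]|z Dz|
    _ [D' [clD' cD'] <-] DD'] :=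
  @compact_directed_cover bX (cl D)
    [set W | exists2 D', clopen D' /\ compact D' & cl D' = W] cclD.
- exists set0; last by rewrite image_set0 closure0.
  by split; [exact: clopen0 | exact: compact0].
- exists (D1 `|` D2); last exact: closure_image_setU.
  by split; [exact: clopenU | exact: compactU].
- exact: (clopen_closure_image clD1).1.
- have [x _ xz] := Dr _ Dz.
  have [D' [clD' cD' D'x]] := compact_clopen_cover X_zd X_lc x.
  exists (cl D'); first by exists D'.
  by rewrite -xz; apply: subset_closure; exists x.
apply: (subclosed_compact clD.2 cD') => x Dx; apply: closure_imageE => //.
by apply: DD'; apply: subset_closure; exists x.
Qed.

Hypothesis X_pc : paracompact_hausdorff X.

(** At a point [z] of [sigma X] the closures of clopen sigma-compact sets form
    a filter base; it converges to [z] because it does so along every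
    coordinate [g], by splitting a set [A0] whose closure contains [z] into a
    part where [g] is close to [g z] and a part where it is not. *)
Lemma sigma_extension_nbhs_base (z : bX) (N : set bX) :
  sigma_extension z -> nbhs z N ->
  exists A, [/\ clopen A, sigma_compact A, cl A z & cl A `<=` N].
Proof.
move=> [K sK Kz].
have [A0 [clA0 sA0 KA0]] := sigma_compact_sub_clopen X_zd X_lc X_pc sK.
have A0z : cl A0 z by move: Kz; apply: closureS; exact: image_subset.
pose F : set_system bX := [set U | exists A,
  [/\ clopen A, sigma_compact A, cl A z & cl A `<=` U]].
have FF : Filter F.
  split; first by exists A0.
    move=> P Q [A [clA sA Az AP]] [B [clB sB Bz BQ]].
    exists (A `&` B); rewrite closure_image_setI//; split=> //.
    - exact: clopenI.
    - exact: sigma_compact_closedI clB.2.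
    - by move=> w [/AP Pw /BQ Qw].
  by move=> P Q PQ [A [? ? ? AP]]; exists A; split=> // w /AP /PQ.
suff : F --> z by apply.
apply: cvg_stone_cech => g. apply/cvgrPdist_le => /= eps eps0.
have cg := @coordinate_continuous g.
pose P := [set x | `|coordinate g z - coordinate g (e x)| < eps].
pose Q := [set x | eps / 2 < `|coordinate g z - coordinate g (e x)|].
have cdist : continuous (fun w : bX => `|coordinate g z - coordinate g w|).
  move=> w; have cst_cvg : (fun=> coordinate g z) @ nbhs w --> coordinate g z.
    exact: cvg_cst.
  have sub_cvg : (fun v => coordinate g z - coordinate g v) @ nbhs w -->
      coordinate g z - coordinate g w by exact: (cvgB cst_cvg (cg w)).
  have H := @cvg_norm _ _ _ _ (nbhs_filter w) _ _ sub_cvg.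
  exact: H.
have cdistX : continuous (fun x : X => `|coordinate g z - coordinate g (e x)|).
  move=> x.
  exact: (continuous_comp (to_stone_cech_continuous (x := x)) (cdist (e x))).
have oP : open P.
  by apply: (open_comp (D := [set r | r < eps])) => // x _; exact: cdistX.
have oQ : open Q.
  by apply: (open_comp (D := [set r | eps / 2 < r])) => // x _; exact: cdistX.
have A0PQ : A0 `<=` P `|` Q.
  move=> x _; have [Px|] := ltP `|coordinate g z - coordinate g (e x)| eps; first by left.
  move=> Px; right; apply: lt_le_trans Px.
  by rewrite ltr_pdivrMr// ltr_pMr// ltr1n.
(* The bounds [eps] and [eps / 2] overlap, so that [P] and [Q] cover [A0],
   while the bound [eps / 2] keeps [z] out of the closure of [C]. *)
have [B [C [clB clC BC BP CQ]]] := sigma_compact_clopen_split X_zd sA0 clA0 oP oQ A0PQ.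
have Bz : cl B z.
  move: A0z; rewrite -BC closure_image_setU => -[//|Cz].
  have : closed [set w : bX | eps / 2 <= `|coordinate g z - coordinate g w|].
    apply: (preimage_closed (D := [set r | eps / 2 <= r])) => [w _|].
      exact: cdist.
    exact: closed_ge.
  move=> /(_ z); rewrite /= subrr normr0 leNgt divr_gt0//.
  suff sub : e @` C `<=` [set w : bX | eps / 2 <= `|coordinate g z - coordinate g w|].
    by move=> /(_ (closureS sub Cz)).
  by move=> _ [x /CQ Qx <-] /=; exact: ltW.
exists B; split=> //.
  rewrite (_ : B = A0 `&` B); first exact: sigma_compact_closedI clB.2.
  by rewrite -BC setUK.
have : closed [set w : bX | `|coordinate g z - coordinate g w| <= eps].
  apply: (preimage_closed (D := [set r | r <= eps])) => [w _|].
    exact: cdist.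
  exact: closed_le.
move=> /closure_id cleps w Bw.
change ([set w : bX | `|coordinate g z - coordinate g w| <= eps] w).
by rewrite cleps; move: Bw; apply: closureS => _ [x /BP Px <-] /=; exact: ltW.
Qed.

End stone_cech_facts.

(** * Compact open subsets of the remainder *)

Section sigma_remainder_facts.
Variables (R : realType) (X : topologicalType).
Hypothesis X_zd : has_clopen_base X.
Hypothesis X_lc : locally_compact_hausdorff X.
Hypothesis X_pc : paracompact_hausdorff X.

Notation bX := (stone_cech R X).
Notation e := (@to_stone_cech R X).
Notation cl D := (closure (e @` D)).

Definition remainder_trace (A : set X) : set (sigma_remainder R X) :=
  [set z | cl A (set_val z)].

Lemma open_remainder_trace (A : set X) : clopen A -> open (remainder_trace A).
Proof. by move=> clA; exists (cl A) => //; exact: (clopen_closure_image R clA).1. Qed.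

Lemma compact_remainder_trace (A : set X) :
  clopen A -> sigma_compact A -> compact (remainder_trace A).
Proof.
move=> clA sA.
rewrite (_ : remainder_trace A = set_val @^-1` (cl A `\` range e)); last first.
  apply/seteqP; split=> z; last by case.
  by move=> Az; split=> //; have [] := set_valP z.
apply: compact_embedding_preimage; first exact: set_val_embedding.
  apply: compact_setD (open_range_to_stone_cech R X_zd X_lc).
  exact: (subclosed_compact (@closed_closure _ _) (@stone_cech_compact R X)).
move=> z [Az nXz].
have zS : (@sigma_extension R X `\` range e) z by split=> //; exists A.
by exists (SigSub (mem_set zS)).
Qed.

Lemma remainder_traceU (A B : set X) :
  remainder_trace (A `|` B) = remainder_trace A `|` remainder_trace B.
Proof. by rewrite /remainder_trace closure_image_setU. Qed.

Lemma remainder_traceD (A B : set X) : clopen A -> clopen B ->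
  remainder_trace (A `\` B) = remainder_trace A `\` remainder_trace B.
Proof. by move=> clA clB; rewrite /remainder_trace closure_image_setD. Qed.

Lemma remainder_trace_eq0 (A : set X) : clopen A -> sigma_compact A ->
  remainder_trace A = set0 <-> compact A.
Proof.
move=> clA sA; rewrite -(compact_closure_imageP R X_zd X_lc clA); split=> [A0 z Az|Ar].
  apply: contrapT => nXz.
  have zS : (@sigma_extension R X `\` range e) z by split=> //; exists A.
  by rewrite -[False]/(set0 (SigSub (mem_set zS) : sigma_remainder R X)) -A0.
by rewrite -subset0 => z /Ar Xz; have [_] := set_valP z; apply.
Qed.

(** [A `\` B] has trace the difference of the traces, which is empty exactly
    when [A `\` B] is compact. *)
Lemma remainder_trace_sub (A B : set X) : clopen A -> sigma_compact A ->
  clopen B -> remainder_trace A `<=` remainder_trace B <-> compact (A `\` B).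
Proof.
move=> clA sA clB; rewrite -remainder_trace_eq0; last first.
- by rewrite setDE; apply: sigma_compact_closedI => //; exact: (clopenC _ clB).2.
- exact: clopen_setD.
by rewrite remainder_traceD// setD_eq0.
Qed.

Lemma remainder_trace_base (z : sigma_remainder R X) (N : set (sigma_remainder R X)) :
  nbhs z N -> exists A, [/\ clopen A, sigma_compact A, remainder_trace A z &
    remainder_trace A `<=` N].
Proof.
move=> [_ [[B oB <-] Bz] BN]; have [zs _] := set_valP z.
have [A [clA sA Az AB]] := sigma_extension_nbhs_base X_zd X_lc X_pc zs
  (open_nbhs_nbhs (conj oB Bz)).
by exists A; split=> // w Aw; apply: BN; exact: AB.
Qed.

Lemma compact_open_remainder_trace (C : set (sigma_remainder R X)) :
  compact C -> open C ->
  exists A, [/\ clopen A, sigma_compact A & remainder_trace A = C].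
Proof.
move=> cC oC.
have [|U V [A [? ? <- AC]] [B [? ? <- BC]]|U [A [clA _ <- _]]|z Cz|
    _ [A [clA sA <- AC]] CA] :=
  @compact_directed_cover _ C [set W | exists A, [/\ clopen A, sigma_compact A,
     remainder_trace A = W & W `<=` C]] cC.
- exists set0; split=> //; [exact: clopen0| |].
    by apply: compact_sigma_compact; exact: compact0.
  by rewrite /remainder_trace image_set0 closure0.
- exists (A `|` B); rewrite remainder_traceU; split=> //; last by rewrite subUset.
    exact: clopenU.
  exact: sigma_compactU.
- exact: open_remainder_trace.
- have [A [clA sA Az AC]] := remainder_trace_base (open_nbhs_nbhs (conj oC Cz)).
  by exists (remainder_trace A) => //; exists A.
by exists A; split=> //; apply/seteqP.
Qed.

Lemma sigma_remainder_hausdorff : hausdorff_space (sigma_remainder R X).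
Proof.
apply: (hausdorff_embedding (@set_val_embedding bX _)).
exact: stone_cech_hausdorff.
Qed.

End sigma_remainder_facts.

(** * Stone duality *)

Definition compact_open_base (S : topologicalType) : Prop :=
  forall (z : S) (N : set S), nbhs z N ->
  exists C, [/\ compact C, open C, C z & C `<=` N].

Definition compact_open (S : topologicalType) : Type :=
  {C : set S | [/\ compact C, open C & C !=set0]}.

Definition compact_open_le (S : topologicalType) (C D : compact_open S) : Prop :=
  sval C `<=` sval D.

Lemma compact_open_eq (S : topologicalType) (C D : compact_open S) :
  sval C = sval D -> C = D.
Proof. by case: C D => [C pC] [D pD] /= CD; exact: eq_exist. Qed.

Section stone_duality_half.
Variables (S T : topologicalType).
Hypotheses (S_haus : hausdorff_space S) (T_haus : hausdorff_space T).
Hypotheses (S_base : compact_open_base S) (T_base : compact_open_base T).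
Variables (F : compact_open S -> compact_open T).
Variables (G : compact_open T -> compact_open S).
Hypotheses (FK : cancel F G) (GK : cancel G F).
Hypothesis F_homo : forall C D, compact_open_le C D -> compact_open_le (F C) (F D).
Hypothesis G_homo : forall C D, compact_open_le C D -> compact_open_le (G C) (G D).

(** Disjointness is an order notion: [C] and [D] meet if and only if they have
    a common lower bound among the nonempty compact open sets. *)
Lemma compact_open_iso_disjoint (C D : compact_open S) :
  sval C `&` sval D = set0 -> sval (F C) `&` sval (F D) = set0.
Proof.
move=> CD0; apply: contrapT => /eqP/set0P[w [Cw Dw]].
have [cFC oFC _] := svalP (F C).
have [cFD oFD _] := svalP (F D).
have oCD : open (sval (F C) `&` sval (F D)) by exact: openI.
have [E [cE oE Ew ECD]] := T_base (open_nbhs_nbhs (conj oCD (conj Cw Dw))).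
pose E' : compact_open T := exist _ E (And3 cE oE (ex_intro _ w Ew)).
have EC : compact_open_le (G E') C.
  by rewrite -[C]FK; apply: G_homo => x /ECD[].
have ED : compact_open_le (G E') D.
  by rewrite -[D]FK; apply: G_homo => x /ECD[].
have [_ _ [x Ex]] := svalP (G E').
by rewrite -[False]/(set0 x) -CD0; split; [exact: EC | exact: ED].
Qed.

(** A point corresponds to the filter of its compact open neighbourhoods.  The
    images of these under [F] have a common point by compactness; if [z] is
    not in [C], it has a compact open neighbourhood disjoint from [C], whose
    image is disjoint from [F C] and contains [w]. *)
Lemma compact_open_iso_point (z : S) :
  exists w : T, forall C, sval C z <-> sval (F C) w.
Proof.
have [C0 [cC0 oC0 C0z _]] := S_base (@filterT _ (nbhs z) _).
pose CO C (cC : compact C) (oC : open C) (Cz : C z) : compact_open S :=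
  exist _ C (And3 cC oC (ex_intro _ z Cz)).
pose P : set_system T := [set U | exists2 C, sval C z & sval (F C) `<=` U].
have FP : ProperFilter P.
  apply: Build_ProperFilter_ex.
    by move=> U [C Cz CU]; have [_ _ [w Cw]] := svalP (F C); exists w; exact: CU.
  split.
  - by exists (CO _ cC0 oC0 C0z).
  - move=> U V [C Cz CU] [D Dz DV].
    have [cC oC _] := svalP C; have [cD oD _] := svalP D.
    have cCD : compact (sval C `&` sval D).
      by apply: compact_closedI => //; exact: compact_closed.
    exists (CO _ cCD (openI oC oD) (conj Cz Dz)) => //= w CDw; split.
      by apply: CU; apply: (F_homo _ CDw) => x [].
    by apply: DV; apply: (F_homo _ CDw) => x [].
  - by move=> U V UV [C Cz CU]; exists C => // w /CU /UV.
pose C0' := CO _ cC0 oC0 C0z.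
have PC0 : P (sval (F C0')) by exists C0'.
have [cFC0 _ _] := svalP (F C0').
have [w [_ clw]] := cFC0 P FP PC0.
have wP C : sval C z -> sval (F C) w.
  move=> Cz; have [cFC _ _] := svalP (F C).
  apply: (compact_closed T_haus cFC) => N nN.
  by apply: clw => //; exists C.
exists w => C; split=> [|Cw]; first exact: wP.
apply: contrapT => nCz; have [cC oC _] := svalP C.
have oD : open (C0 `\` sval C).
  by apply: open_setD => //; exact: compact_closed.
have cD : compact (C0 `\` sval C) by exact: compact_setD.
pose D := CO _ cD oD (conj C0z nCz).
have DC0 : (C0 `\` sval C) `&` sval C = set0 by rewrite setDE -setIA setICl setI0.
rewrite -[False]/(set0 w) -(@compact_open_iso_disjoint D C DC0); split=> //.
exact: wP.
Qed.

End stone_duality_half.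

(** In one direction, [compact_open_iso_point] applied to an order isomorphism
    and to its inverse gives maps [f] and [g]; the preimage of [F C] under [f]
    is [C], so [f] is continuous, and points are separated by compact open
    sets, so [f] and [g] are inverse to each other. *)
Lemma stone_duality (S T : topologicalType) :
  hausdorff_space S -> hausdorff_space T ->
  compact_open_base S -> compact_open_base T ->
  order_isomorphic (@compact_open_le S) (@compact_open_le T) <->
  homeomorphic S T.
Proof.
move=> hS hT bS bT; split; last first.
  have image_co (S' T' : topologicalType) (f : S' -> T') (g : T' -> S') :
      continuous f -> continuous g -> cancel f g -> cancel g f ->
      forall C : set S', [/\ compact C, open C & C !=set0] ->
      [/\ compact (f @` C), open (f @` C) & f @` C !=set0].
    move=> cf cg fK gK C [cC oC C0]; split; last exact/image_nonempty.
      exact: compact_continuous_image.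
    rewrite (_ : f @` C = g @^-1` C); first by apply: open_comp => // x _; exact: cg.
    apply/seteqP; split=> x; first by move=> [y Cy <-]; rewrite /= fK.
    by move=> Cgx; exists (g x); rewrite ?gK.
  move=> [f [g [cf cg fK gK]]].
  exists (fun C => exist _ _ (image_co _ _ _ _ cf cg fK gK _ (svalP C))).
  exists (fun C => exist _ _ (image_co _ _ _ _ cg cf gK fK _ (svalP C))).
  split.
  - by move=> C; apply: compact_open_eq => /=; rewrite image_comp
      (funext fK : g \o f = id) image_id.
  - by move=> C; apply: compact_open_eq => /=; rewrite image_comp
      (funext gK : f \o g = id) image_id.
  - by move=> C D CD; exact: image_subset.
  - by move=> C D CD; exact: image_subset.
move=> [F [G [FK GK hF hG]]].
have [f fP] := choice (compact_open_iso_point hS hT bS bT FK hF hG).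
have [g gP] := choice (compact_open_iso_point hT hS bT bS GK hG hF).
have eqP (S' : topologicalType) : hausdorff_space S' -> compact_open_base S' ->
    forall x y : S', (forall C : compact_open S', sval C x -> sval C y) -> x = y.
  move=> hS' bS' x y xy; apply: hS' => A B nA nB.
  have [C [cC oC Cx CA]] := bS' _ _ nA.
  exists y; split; last exact: nbhs_singleton.
  by apply: CA; exact: (xy (exist _ C (And3 cC oC (ex_intro _ x Cx)))).
exists f, g; split.
- move=> z N nN; have [C [cC oC Cz CN]] := bT _ _ nN.
  pose C' : compact_open T := exist _ C (And3 cC oC (ex_intro _ (f z) Cz)).
  have [_ oGC _] := svalP (G C').
  apply: (@filterS _ (nbhs z) _ (sval (G C'))).
    by move=> x /fP; rewrite GK => /CN.
  by apply: open_nbhs_nbhs; split=> //; apply/fP; rewrite GK.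
- move=> z N nN; have [C [cC oC Cz CN]] := bS _ _ nN.
  pose C' : compact_open S := exist _ C (And3 cC oC (ex_intro _ (g z) Cz)).
  have [_ oFC _] := svalP (F C').
  apply: (@filterS _ (nbhs z) _ (sval (F C'))).
    by move=> x /gP; rewrite FK => /CN.
  by apply: open_nbhs_nbhs; split=> //; apply/gP; rewrite FK.
- by move=> z; apply/esym/eqP => // C /fP /gP; rewrite FK.
- by move=> z; apply/esym/eqP => // C /gP /fP; rewrite GK.
Qed.

(** * Locally compact one-point extensions and their traces *)

Section one_point_extension_facts.
Variables (X : topologicalType) (T : one_point_extension X).

Notation i := (ope_incl T).
Notation p := (ope_point T).

Lemma ope_hausdorff : hausdorff_space T.
Proof. by have [] := ope_tychonoff T. Qed.

Lemma ope_incl_inj : injective i.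
Proof. by have [] := ope_embedding T. Qed.

Lemma ope_incl_continuous : continuous i.
Proof. by apply/continuousP => B oB; apply/(ope_embedding T).2; exists B. Qed.

Lemma ope_incl_neq_point (x : X) : i x <> p.
Proof.
move=> ixp; have : [set p] p by [].
by rewrite -ope_remainder; apply; exists x.
Qed.

Lemma range_ope_inclE : range i = ~` [set p].
Proof. by rewrite -ope_remainder setCK. Qed.

Lemma ope_case (t : T) : t = p \/ exists x, t = i x.
Proof.
have [tp|tp] := pselect (t = p); first by left.
have : (~` [set p]) t by [].
by rewrite -range_ope_inclE => -[x _ <-]; right; exists x.
Qed.

Lemma open_range_ope_incl : open (range i).
Proof.
rewrite range_ope_inclE; apply: closed_openC; apply: accessible_closed_set1.
by apply: hausdorff_accessible; exact: ope_hausdorff.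
Qed.

Lemma open_ope_incl_image (U : set X) : open U -> open (i @` U).
Proof.
move=> /(ope_embedding T).2[B oB <-].
rewrite (_ : _ @` _ = B `&` range i).
  by apply: openI => //; exact: open_range_ope_incl.
apply/seteqP; split=> t; first by move=> [x Bx <-]; split=> //; exists x.
by move=> [+ [x _ xt]]; rewrite -xt => Bx; exists x.
Qed.

Lemma compact_ope_incl_preimage (K : set T) : compact K -> ~ K p ->
  compact (i @^-1` K).
Proof.
move=> cK nKp; apply: compact_embedding_preimage => //; first exact: ope_embedding.
by rewrite range_ope_inclE => t Kt /= tp; apply: nKp; rewrite -tp.
Qed.

Lemma closed_ope_incl_image (L : set X) : compact L -> closed (i @` L).
Proof.
move=> cL; apply: compact_closed; first exact: ope_hausdorff.
by apply: compact_continuous_image => //; exact: ope_incl_continuous.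
Qed.

(** The sets [A] for which [T] looks, near its added point, like the one-point
    compactification of [A].  They are determined by [T] up to relatively
    compact sets only. *)
Definition end_trace (A : set X) : Prop :=
  exists K : set T, [/\ compact K, open K, K p & i @^-1` K = A].

Hypothesis X_zd : has_clopen_base X.
Hypothesis X_lc : locally_compact_hausdorff X.

(** The boundary of a compact neighbourhood of [p] is a compact subset of [X],
    hence lies in a compact clopen subset of [X]; removing the latter leaves a
    compact open neighbourhood of [p]. *)
Lemma exists_end_trace : locally_compact_hausdorff T -> exists A, end_trace A.
Proof.
move=> [_ /(locally_compact_nbhs p)[U nU cU]].
have cB : compact (U `\` U°).
  by apply: compact_setD => //; exact: open_interior.
have [|V W [D1 [? ?] <-] [D2 [? ?] <-]|W [D [[oD _] _] <-]|t [Ut nUt]|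
    _ [D [clD cD] <-] BD] :=
  @compact_directed_cover T _
    [set W | exists2 D, clopen D /\ compact D & i @` D = W] cB.
- exists set0; last by rewrite image_set0.
  by split; [exact: clopen0 | exact: compact0].
- exists (D1 `|` D2); last by rewrite image_setU.
  by split; [exact: clopenU | exact: compactU].
- exact: open_ope_incl_image.
- case: (ope_case t) => [tp|[x tx]]; first by case: nUt; rewrite tp; exact: nU.
  have [D [clD cD Dx]] := compact_clopen_cover X_zd X_lc x.
  by exists (i @` D); [exists D | exists x].
pose K := U `\` i @` D.
have KE : K = U° `\` i @` D.
  apply/seteqP; split=> t [Ut nDt]; split=> //; last exact: interior_subset.
  by apply: contrapT => nUt; apply: nDt; exact: BD.
exists (i @^-1` K), K; split=> //.
- apply: compact_setD => //; exact: open_ope_incl_image clD.1.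
- rewrite KE; apply: open_setD; first exact: open_interior.
  exact: closed_ope_incl_image.
- by rewrite KE; split=> // -[x _]; exact: ope_incl_neq_point.
Qed.

Lemma end_trace_clopen (A : set X) : end_trace A -> clopen A.
Proof.
move=> [K [cK oK _ <-]]; apply: preimage_clopen; last exact: ope_incl_continuous.
by split=> //; apply: compact_closed => //; exact: ope_hausdorff.
Qed.

Lemma end_trace_not_compact (A : set X) : end_trace A -> ~ compact A.
Proof.
move=> [K [cK oK Kp KA]] cA.
have o : open (K `\` i @` A).
  by apply: open_setD => //; exact: closed_ope_incl_image.
have [|t [[Kt nA] [x _ xt]]] := ope_dense _ o.
  by exists p; split=> // -[x _]; exact: ope_incl_neq_point.
by apply: nA; exists x; rewrite // -KA /= xt.
Qed.

(** If the [f n] form a countable base at [p], then [K] without [p] is the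
    union of the compact sets [K `\` f n]. *)
Lemma end_trace_sigma_compact (A : set X) : first_countable_at p ->
  end_trace A -> sigma_compact A.
Proof.
move=> [B [cB oB Bbase]] [K [cK oK Kp <-]].
have [B0 B0B _] := Bbase setT filterT.
have [f Bf] : exists f : nat -> set T, B = range f.
  have /pfcard_geP[BE|] := cB; first by rewrite BE in B0B.
  by move=> /unsquash f; exists f; rewrite image_eq.
have fB n : B (f n) by rewrite Bf; exists n.
exists (fun n => i @^-1` (K `\` f n)); split.
  move=> n; have [ofn fnp] := oB _ (fB n).
  apply: compact_ope_incl_preimage; last by case.
  exact: compact_setD.
apply/seteqP; split=> x; last by move=> [n _ []].
move=> Kx; have : nbhs p (~` [set i x]).
  apply: open_nbhs_nbhs; split; last by move=> /esym; exact: ope_incl_neq_point.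
  apply: closed_openC; apply: accessible_closed_set1.
  by apply: hausdorff_accessible; exact: ope_hausdorff.
move=> /Bbase[U]; rewrite Bf => -[n _ <-] fn.
by exists n => //; split=> // fnx; exact: (fn _ fnx erefl).
Qed.

End one_point_extension_facts.

Lemma ope_le_trans (X : topologicalType) (T1 T2 T3 : one_point_extension X) :
  ope_le T1 T2 -> ope_le T2 T3 -> ope_le T1 T3.
Proof.
move=> [f [cf fE]] [g [cg gE]]; exists (f \o g); split.
  by move=> x; apply: continuous_comp; [exact: cg | exact: cf].
by move=> x; rewrite /= gE fE.
Qed.

(** If [f] sent the added point to a point [x] of [X], then for a compact clopen
    neighbourhood [D] of [x] the preimage of [D] minus [D] itself would be
    open and nonempty, but would miss the dense subset [X]. *)
Lemma ope_le_point (X : topologicalType) (T1 T2 : one_point_extension X)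
    (f : T1 -> T2) : has_clopen_base X -> locally_compact_hausdorff X ->
  continuous f -> (forall x, f (ope_incl T1 x) = ope_incl T2 x) ->
  f (ope_point T1) = ope_point T2.
Proof.
move=> X_zd X_lc cf fE; have [//|[x fx]] := ope_case (f (ope_point T1)).
have [D [[oD _] cD Dx]] := compact_clopen_cover X_zd X_lc x.
have o : open (f @^-1` (ope_incl T2 @` D) `\` ope_incl T1 @` D).
  apply: open_setD; last exact: closed_ope_incl_image.
  by apply: open_comp => [? _|]; [exact: cf | exact: open_ope_incl_image].
have [|t [[/= [z Dz fz] nD] [y _ yE]]] := ope_dense _ o.
  exists (ope_point T1); split; first by exists x.
  by move=> [y _]; exact: ope_incl_neq_point.
case: nD; exists z => //; rewrite -yE; congr ope_incl.
by apply: (@ope_incl_inj _ T2); rewrite fz -yE fE.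
Qed.

(** For the converse, the map that fixes [X] and sends added point to added
    point is continuous: if [U] is a neighbourhood of the point of [T2], then
    [A2 `\` U] is compact, hence [A1 `\` U] is contained in the compact set
    [M], and [K1 `\` M] is a neighbourhood of the point of [T1] sent into [U]. *)
Lemma ope_leP (X : topologicalType) (T1 T2 : one_point_extension X)
    (A1 A2 : set X) : has_clopen_base X -> locally_compact_hausdorff X ->
  end_trace T1 A1 -> end_trace T2 A2 ->
  ope_le T2 T1 <-> compact (A1 `\` A2).
Proof.
move=> X_zd X_lc tr1 tr2; split.
  move=> [f [cf fE]]; have fp := ope_le_point X_zd X_lc cf fE.
  case: tr1 tr2 => K1 [cK1 oK1 K1p <-] [K2 [cK2 oK2 K2p <-]].
  rewrite (_ : _ `\` _ = ope_incl T1 @^-1` (K1 `\` f @^-1` K2)); last first.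
    apply/seteqP; split=> x [? nK2]; split=> //= K2x; apply: nK2.
      by move: K2x; rewrite /= fE.
    by rewrite /= fE.
  apply: compact_ope_incl_preimage; last by move=> [_]; apply; rewrite /= fp.
  apply: compact_setD => //; apply: open_comp => // ? _; exact: cf.
move=> cA12.
have fex (t : T1) : exists s : T2,
    (t = ope_point T1 -> s = ope_point T2) /\
    (forall x, t = ope_incl T1 x -> s = ope_incl T2 x).
  have [->|[x ->]] := ope_case t.
    exists (ope_point T2); split=> // x /esym xp.
    by have := ope_incl_neq_point xp.
  exists (ope_incl T2 x); split=> [xp|y /ope_incl_inj -> //].
  by have := ope_incl_neq_point xp.
have [f fP] := choice fex.
have fp : f (ope_point T1) = ope_point T2 by have [h _] := fP (ope_point T1); exact: h.
have fE x : f (ope_incl T1 x) = ope_incl T2 x.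
  by have [_ h] := fP (ope_incl T1 x); exact: h.
exists f; split=> //; apply/continuousP => U oU.
have oiU : open (ope_incl T2 @^-1` U).
  by apply: open_comp => // ? _; exact: ope_incl_continuous.
have oi1 : open (ope_incl T1 @` (ope_incl T2 @^-1` U)) by exact: open_ope_incl_image.
have [Up|nUp] := pselect (U (ope_point T2)); last first.
  rewrite (_ : f @^-1` U = ope_incl T1 @` (ope_incl T2 @^-1` U)) //.
  apply/seteqP; split=> t; last by move=> [x Ux <-]; rewrite /= fE.
  have [->|[x ->]] := ope_case t; first by rewrite /= fp.
  by rewrite /= fE => Ux; exists x.
case: tr1 tr2 cA12 => K1 [cK1 oK1 K1p <-] [K2 [cK2 oK2 K2p <-]] cA12.
have cM : compact (ope_incl T2 @^-1` (K2 `\` U)).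
  apply: compact_ope_incl_preimage; last by case.
  exact: compact_setD.
pose M := (ope_incl T1 @^-1` K1 `\` ope_incl T2 @^-1` K2) `|`
          ope_incl T2 @^-1` (K2 `\` U).
have cMM : closed (ope_incl T1 @` M).
  by apply: closed_ope_incl_image; exact: compactU.
rewrite (_ : f @^-1` U =
    (K1 `\` ope_incl T1 @` M) `|` ope_incl T1 @` (ope_incl T2 @^-1` U)).
  by apply: openU => //; exact: open_setD.
apply/seteqP; split=> t.
  have [-> _|[x ->]] := ope_case t.
    by left; split=> // -[x _]; exact: ope_incl_neq_point.
  by rewrite /= fE => Ux; right; exists x.
case=> [|[x Ux <-]]; last by rewrite /= fE.
have [->|[x ->]] := ope_case t; first by rewrite /= fp.
move=> [K1x nM]; rewrite /= fE; apply: contrapT => nUx; apply: nM; exists x => //.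
have [K2x|nK2x] := pselect (K2 (ope_incl T2 x)); first by right.
by left.
Qed.

Lemma ope_equivP (X : topologicalType) (T1 T2 : one_point_extension X) :
  has_clopen_base X -> locally_compact_hausdorff X ->
  ope_equiv T1 T2 <-> ope_le T1 T2 /\ ope_le T2 T1.
Proof.
move=> X_zd X_lc; split.
  move=> [f [g [cf cg fK gK fE]]]; split; last by exists f.
  by exists g; split=> // x; rewrite -fE fK.
move=> [[g [cg gE]] [f [cf fE]]].
have fp := ope_le_point X_zd X_lc cf fE; have gp := ope_le_point X_zd X_lc cg gE.
exists f, g; split=> //.
  by move=> t; have [->|[x ->]] := ope_case t; rewrite ?fp ?gp ?fE ?gE.
by move=> t; have [->|[x ->]] := ope_case t; rewrite ?gp ?fp ?gE ?fE.
Qed.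

Lemma ope_equiv_refl (X : topologicalType) (T : one_point_extension X) :
  ope_equiv T T.
Proof. by exists id, id; split=> // x; exact: cvg_id. Qed.

Lemma ope_class_eq (X : topologicalType) (T1 T2 : one_point_extension X) :
  has_clopen_base X -> locally_compact_hausdorff X ->
  ope_le T1 T2 -> ope_le T2 T1 -> ope_class T1 = ope_class T2.
Proof.
move=> X_zd X_lc le12 le21; apply/funext => U; apply/propext.
split=> /(ope_equivP _ _ X_zd X_lc)[h1 h2]; apply/(ope_equivP _ _ X_zd X_lc).
  by split; [exact: ope_le_trans h1 | exact: ope_le_trans le12].
by split; [exact: ope_le_trans h1 | exact: ope_le_trans le21].
Qed.

(** * The extension with a prescribed trace *)

(** The parameter [A] selects the topology: [None] is a limit of the points of
    [A] that leave every compact set, so that only [A] acquires a new point. *)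
Definition adjoin_end (X : topologicalType) (A : set X) : Type := option X.

Section adjoin_end_topology.
Variables (X : topologicalType) (A : set X).

Notation XA := (adjoin_end A).
Notation some := (Some : X -> XA).

HB.instance Definition _ := Choice.on XA.

Definition adjoin_end_open : set (set XA) :=
  [set U | open (some @^-1` U) /\
           (U None -> exists2 L, compact L & A `\` some @^-1` U `<=` L)].

Let opT : adjoin_end_open setT.
Proof.
split; first exact: openT.
by move=> _; exists set0; [exact: compact0 | move=> x [_]; apply].
Qed.

Let opI : setI_closed adjoin_end_open.
Proof.
move=> U V [oU UL] [oV VL]; split; first exact: openI.
move=> [/UL[L cL AL] /VL[M cM AM]]; exists (L `|` M); first exact: compactU.
move=> x [Ax /not_andP[nU|nV]]; first by left; exact: AL.
by right; exact: AM.
Qed.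

Let op_bigU (I : Type) (f : I -> set XA) :
  (forall i, adjoin_end_open (f i)) -> adjoin_end_open (\bigcup_i f i).
Proof.
move=> of_; split.
  by rewrite preimage_bigcup; apply: bigcup_open => i _; have [] := of_ i.
move=> [i _ fi]; have [_ /(_ fi)[L cL AL]] := of_ i; exists L => //.
by move=> x [Ax nx]; apply: AL; split=> // fix_; apply: nx; exists i.
Qed.

HB.instance Definition _ := isOpenTopological.Build XA opT opI op_bigU.

Lemma adjoin_end_openE (U : set XA) : open U = adjoin_end_open U.
Proof. by []. Qed.

Lemma adjoin_end_open_some (U : set X) : open U -> open (some @` U).
Proof.
move=> oU; rewrite adjoin_end_openE; split; last by move=> [].
rewrite (_ : _ @^-1` _ = U)//; apply/seteqP; split=> x; last by exists x.
by move=> [y Uy [<-]].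
Qed.

Lemma adjoin_end_some_continuous : continuous some.
Proof. by apply/continuousP => U []. Qed.

Lemma adjoin_end_embedding : topological_embedding some.
Proof.
split; first by move=> x y [].
move=> U; split=> [oU|[B [oB _] <-//]].
exists (some @` U); first exact: adjoin_end_open_some.
by apply/seteqP; split=> x; [move=> [y Uy [<-]] | exists x].
Qed.

Hypothesis X_zd : has_clopen_base X.
Hypothesis X_lc : locally_compact_hausdorff X.
Hypotheses (clA : clopen A) (sA : sigma_compact A) (ncA : ~ compact A).

Lemma adjoin_end_dense : dense (range some).
Proof.
move=> U [[x|] Ux] [oU AL]; first by exists (Some x); split=> //; exists x.
have [L cL ALs] := AL Ux.
have [[x Sx]|nx] := pselect (exists x : X, U (Some x)).
  by exists (Some x); split=> //; exists x.
exfalso; apply: ncA; apply: (subclosed_compact clA.2 cL) => x Axx.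
by apply: ALs; split=> // Sx; apply: nx; exists x.
Qed.

Lemma adjoin_end_remainder : ~` range some = [set None].
Proof.
apply/seteqP; split=> [[x|]//|_ -> [x _] //].
by move=> nx; exfalso; apply: nx; exists x.
Qed.

Lemma open_adjoin_end (D : set X) : clopen D -> compact D ->
  open (~` (some @` (~` A `|` D))).
Proof.
move=> clD cD; rewrite adjoin_end_openE; split.
  rewrite (_ : _ @^-1` _ = A `\` D).
    by apply: (clopen_setD clA clD).1.
  apply/seteqP; split=> x.
    move=> nx; split; first by apply: contrapT => nAx; apply: nx; exists x => //; left.
    by move=> Dx; apply: nx; exists x => //; right.
  by move=> [Ax nDx] [y + [yx]]; rewrite yx => -[].
move=> _; exists D => // x [Ax /contrapT[y + [yx]]]; rewrite yx => -[]//.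
Qed.

Lemma open_end_nbhs : open (~` (some @` (~` A))).
Proof.
by rewrite -[~` A]setU0; apply: open_adjoin_end; [exact: clopen0 | exact: compact0].
Qed.

Lemma adjoin_end_hausdorff : hausdorff_space XA.
Proof.
have sepN (x : X) : exists U V : set XA,
    [/\ open U, open V, U (Some x), V None & U `&` V = set0].
  have [D [clD cD Dx]] := compact_clopen_cover X_zd X_lc x.
  exists (some @` D), (~` (some @` (~` A `|` D))); split.
  - exact: adjoin_end_open_some clD.1.
  - exact: open_adjoin_end.
  - by exists x.
  - by case.
  - rewrite -subset0 => _ [[y Dy <-]]; apply; exists y => //; by right.
move=> [x|] [y|] clxy //.
- congr Some; have [hX _] := X_lc; apply: hX => U V nU nV.
  have nS z W : nbhs z W -> nbhs (some z) (some @` W).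
    rewrite nbhsE => -[W' [oW' W'z] W'W].
    apply: (@filterS _ _ _ (some @` W')); first exact: image_subset.
    by apply: open_nbhs_nbhs; split; [exact: adjoin_end_open_some | exists z].
  have [_ [[u Uu <-] [v Vv [vu]]]] := clxy _ _ (nS _ _ nU) (nS _ _ nV).
  by exists u; split=> //; rewrite -vu.
- have [U [V [oU oV Ux VN UV]]] := sepN x.
  have [t] := clxy U V (open_nbhs_nbhs (conj oU Ux)) (open_nbhs_nbhs (conj oV VN)).
  by rewrite UV.
- have [U [V [oU oV Ux VN UV]]] := sepN y.
  have [t] := clxy V U (open_nbhs_nbhs (conj oV VN)) (open_nbhs_nbhs (conj oU Ux)).
  by rewrite setIC UV.
Qed.

(** [A] together with the added point is the one-point compactification of
    [A]: outside a neighbourhood of [None] only a compact part of [A] remains. *)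
Lemma compact_adjoin_end : compact (~` (some @` (~` A))).
Proof.
have oN := open_end_nbhs.
apply/compact_near_coveringP => I F P FF FT.
have [|[U J] [/= nU FJ] UJP] := FT None; first by case.
move: nU; rewrite nbhsE => -[U' [[oU' AL] U'N] U'U].
have [L cL ALs] := AL U'N.
have cAL : compact (some @` (A `&` L)).
  apply: compact_continuous_image; first exact: adjoin_end_some_continuous.
  by rewrite setIC; apply: compact_closedI => //; exact: clA.2.
have ALP t : (some @` (A `&` L)) t -> \forall x' \near t & i \near F, P i x'.
  by move=> [x [Ax Lx] <-]; apply: FT => -[y nAy [yx]]; apply: nAy; rewrite yx.
have cov := (compact_near_coveringP _).1 cAL _ F P FF ALP.
apply: filterS2 FJ cov => i Ji Pi t nt.
have [Ut|nUt] := pselect (U' t); first exact: (UJP (t, i) (conj (U'U _ Ut) Ji)).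
apply: Pi; case: t nt nUt => [x|] // nt nUx; exists x => //.
have Ax : A x by apply: contrapT => nAx; apply: nt; exists x.
by split=> //; exact: ALs.
Qed.

Lemma adjoin_end_locally_compact : locally_compact [set: XA].
Proof.
suff H (t : XA) : exists U, [/\ open U, compact U & U t].
  move=> t _; have [U [oU cU Ut]] := H t; exists U.
    apply: (@filterS _ (nbhs t) _ U) => //.
    by apply: open_nbhs_nbhs.
  by split=> //; apply: compact_closed => //; exact: adjoin_end_hausdorff.
case: t => [x|].
  have [D [clD cD Dx]] := compact_clopen_cover X_zd X_lc x.
  exists (some @` D); split; [exact: adjoin_end_open_some clD.1| |by exists x].
  by apply: compact_continuous_image => //; exact: adjoin_end_some_continuous.
exists (~` (some @` (~` A))); split; last by case.
  exact: open_end_nbhs.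
exact: compact_adjoin_end.
Qed.

(** For compact clopen sets [E n] increasing with union containing [A], the sets
    [A `\` E n] together with the end form a base at the end, because every
    compact part of [A] lies in some [E n]. *)
Lemma adjoin_end_first_countable : first_countable_at (None : XA).
Proof.
have [K [cK AK]] := sA.
have /choice[D HD] n : exists D, [/\ clopen D, compact D & K n `<=` D].
  exact: (compact_sub_compact_clopen X_zd X_lc (cK n)).
pose E n := \big[setU/set0]_(k < n) D k.
have clE n : clopen (E n) /\ compact (E n).
  rewrite /E; elim/big_ind: _ => [|U V [? ?] [? ?]|k _].
  - by split; [exact: clopen0 | exact: compact0].
  - by split; [exact: clopenU | exact: compactU].
  - by have [] := HD k.
exists (range (fun n => ~` (some @` (~` A `|` E n)))); split.
- by apply: card_image_le.
- move=> _ [n _ <-]; split; last by case.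
  by have [? ?] := clE n; exact: open_adjoin_end.
move=> N; rewrite nbhsE => -[U [[oU AL] UN] UsubN].
have [L cL ALs] := AL UN.
have cAU : compact (A `\` some @^-1` U).
  apply: (subclosed_compact _ cL) => //.
  by rewrite setDE; apply: closedI; [exact: clA.2 | exact: open_closedC].
have mono m n : (m <= n)%N -> E m `<=` E n.
  move=> mn; rewrite /E -!(bigcup_mkord _ D) => x [k km Dx]; exists k => //.
  exact: leq_trans mn.
have [|V W [m <-] [n <-]|V [n <-]|x [Ax _]|_ [n <-] AE] :=
  @compact_directed_cover X _ [set V | exists n, E n = V] cAU.
- by exists 0%N; rewrite /E big_ord0.
- exists (maxn m n); apply/seteqP; split.
    have [mn|nm] := leqP m n; first exact: subsetUr.
    exact: subsetUl.
  by rewrite subUset; split; apply: mono; rewrite ?leq_maxl ?leq_maxr.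
- by have [[]] := clE n.
- move: Ax; rewrite AK => -[n _ Kx]; exists (E n.+1); first by exists n.+1.
  rewrite /E -(bigcup_mkord _ D); exists n => //=.
  by have [_ _] := HD n; apply.
exists (~` (some @` (~` A `|` E n))); first by exists n.
move=> [x|] nx; last exact: UsubN.
apply: UsubN; apply: contrapT => nUx; apply: nx; exists x => //.
have [Ax|nAx] := pselect (A x); last by left.
by right; exact: AE.
Qed.

Lemma adjoin_end_tychonoff (R : realType) : tychonoff_space XA.
Proof.
split; first exact: adjoin_end_hausdorff.
apply: (@locally_compact_completely_regular _ R).
  exact: adjoin_end_locally_compact.
exact: adjoin_end_hausdorff.
Qed.

Definition adjoin_end_extension (R : realType) : one_point_extension X :=
  OnePointExtension (adjoin_end_tychonoff R) adjoin_end_embedding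
    adjoin_end_dense adjoin_end_remainder.

Lemma adjoin_end_in_TK (R : realType) : in_TK (adjoin_end_extension R).
Proof.
split; last exact: adjoin_end_first_countable.
by split; [exact: adjoin_end_hausdorff | exact: adjoin_end_locally_compact].
Qed.

Lemma adjoin_end_trace (R : realType) : end_trace (adjoin_end_extension R) A.
Proof.
exists (~` (some @` (~` A))); split.
- exact: compact_adjoin_end.
- exact: open_end_nbhs.
- by case.
- apply/seteqP; split=> x /=.
    by move=> nx; apply: contrapT => nAx; apply: nx; exists x.
  by move=> Ax [y nAy [yx]]; apply: nAy; rewrite yx.
Qed.

End adjoin_end_topology.

(** * The duality between extensions and the remainder *)

Section extension_poset_duality.
Variables (R : realType) (X : topologicalType).
Hypothesis X_zd : has_clopen_base X.
Hypothesis X_lc : locally_compact_hausdorff X.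
Hypothesis X_pc : paracompact_hausdorff X.

Definition represents (A : set X) (C : TK X) : Prop :=
  exists T, sval C = ope_class T /\ end_trace T A.

Lemma exists_represents (C : TK X) :
  exists A, [/\ clopen A, sigma_compact A, ~ compact A & represents A C].
Proof.
have [T [lcT fcT] CT] := svalP C.
have [A TA] := exists_end_trace X_zd X_lc lcT; exists A; split.
- exact: end_trace_clopen TA.
- exact: end_trace_sigma_compact fcT TA.
- exact: end_trace_not_compact TA.
- by exists T.
Qed.

Lemma exists_represented (A : set X) :
  clopen A -> sigma_compact A -> ~ compact A -> exists C, represents A C.
Proof.
move=> clA sA ncA; pose T := adjoin_end_extension X_zd X_lc clA ncA R.
have inT : in_TK T := adjoin_end_in_TK X_zd X_lc clA sA ncA R.
exists (exist _ (ope_class T) (ex_intro2 _ _ T inT erefl)), T.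
by split=> //; exact: adjoin_end_trace.
Qed.

Lemma TK_leP (C D : TK X) (A B : set X) :
  represents A C -> represents B D -> TK_le C D <-> compact (B `\` A).
Proof.
move=> [TC [CT TA]] [TD [DT TB]]; rewrite -(ope_leP X_zd X_lc TB TA); split.
  move=> [T2 [T1 []]]; rewrite CT DT => /(ope_equivP _ _ X_zd X_lc)[CT2 _].
  move=> /(ope_equivP _ _ X_zd X_lc)[_ T1D] T21.
  exact: ope_le_trans CT2 (ope_le_trans T21 T1D).
by move=> CD; exists TC, TD; rewrite CT DT; split; [exact: ope_equiv_refl..|].
Qed.

Lemma TK_le_refl (C : TK X) : TK_le C C.
Proof.
have [A [_ _ _ AC]] := exists_represents C.
by apply/(TK_leP AC AC); rewrite setDv; exact: compact0.
Qed.

Lemma TK_le_anti (C D : TK X) : TK_le C D -> TK_le D C -> C = D.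
Proof.
have [A [_ _ _ AC]] := exists_represents C.
have [B [_ _ _ BD]] := exists_represents D.
move=> /(TK_leP AC BD) BA /(TK_leP BD AC) AB.
have [TC [CT TA]] := AC; have [TD [DT TB]] := BD.
have eqT : ope_class TC = ope_class TD.
  apply: (ope_class_eq X_zd X_lc); first exact/(ope_leP X_zd X_lc TB TA).
  exact/(ope_leP X_zd X_lc TA TB).
case: C D CT DT {AC BD} => [C pC] [D pD] /= CT DT.
by apply: eq_exist; rewrite CT DT.
Qed.

(** A class of extensions goes to the trace on the remainder of any set that
    represents it; two such sets differ by relatively compact sets, which
    leave no trace there. *)
Lemma TK_dual :
  exists (phi : TK X -> compact_open (sigma_remainder R X))
         (psi : compact_open (sigma_remainder R X) -> TK X),
  [/\ cancel phi psi, cancel psi phi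
    & forall C D, TK_le C D <-> compact_open_le (phi D) (phi C)].
Proof.
have [a aP] := choice exists_represents.
have co C : [/\ compact (@remainder_trace R _ (a C)),
    open (@remainder_trace R _ (a C)) & @remainder_trace R _ (a C) !=set0].
  have [clA sA ncA _] := aP C; split.
  - exact: compact_remainder_trace.
  - exact: open_remainder_trace.
  - by apply/set0P/eqP => /(remainder_trace_eq0 R X_zd X_lc clA sA).
pose phi C : compact_open (sigma_remainder R X) := exist _ _ (co C).
have phi_le C D : TK_le C D <-> compact_open_le (phi D) (phi C).
  have [clA _ _ AC] := aP C; have [clB sB _ BD] := aP D.
  by rewrite (TK_leP AC BD) -(remainder_trace_sub R X_zd X_lc clB sB clA).
have surj E : exists C, phi C = E.
  have [cE oE [z Ez]] := svalP E.
  have [A [clA sA AE]] := compact_open_remainder_trace X_zd X_lc X_pc cE oE.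
  have ncA : ~ compact A.
    move=> /(remainder_trace_eq0 R X_zd X_lc clA sA).
    by rewrite AE => E0; rewrite E0 in Ez.
  have [C AC] := exists_represented clA sA ncA.
  have [clB sB _ BC] := aP C.
  exists C; apply: compact_open_eq => /=; rewrite -AE.
  apply/seteqP; split; apply/(remainder_trace_sub R X_zd X_lc) => //.
    by apply/(TK_leP AC BC); exact: TK_le_refl.
  by apply/(TK_leP BC AC); exact: TK_le_refl.
have [psi psiP] := choice surj.
exists phi, psi; split=> // C.
by apply: TK_le_anti; apply/phi_le; rewrite psiP.
Qed.

End extension_poset_duality.

Lemma order_isomorphic_transfer (P P' Q Q' : Type) (leP : P -> P -> Prop)
    (leP' : P' -> P' -> Prop) (leQ : Q -> Q -> Prop) (leQ' : Q' -> Q' -> Prop)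
    (phi : P -> Q) (psi : Q -> P) (phi' : P' -> Q') (psi' : Q' -> P') :
  cancel phi psi -> cancel psi phi -> cancel phi' psi' -> cancel psi' phi' ->
  (forall x y, leP x y <-> leQ (phi y) (phi x)) ->
  (forall x y, leP' x y <-> leQ' (phi' y) (phi' x)) ->
  order_isomorphic leP leP' <-> order_isomorphic leQ leQ'.
Proof.
move=> phiK psiK phiK' psiK' le le'; split=> -[f [g [fK gK hf hg]]].
  exists (phi' \o f \o psi), (phi \o g \o psi'); split=> [x|x|x y xy|x y xy] /=.
  - by rewrite phiK' fK psiK.
  - by rewrite phiK gK psiK'.
  - by apply/le'/hf/le; rewrite !psiK.
  - by apply/le/hg/le'; rewrite !psiK'.
exists (psi' \o f \o phi), (psi \o g \o phi'); split=> [x|x|x y xy|x y xy] /=.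
- by rewrite psiK' fK phiK.
- by rewrite psiK gK phiK'.
- by apply/le'; rewrite !psiK'; apply/hf/le.
- by apply/le; rewrite !psiK; apply/hg/le'.
Qed.

Theorem theorem3p9 (R : realType) (X Y : topologicalType)
  (X_zd : has_clopen_base X) (X_lc : locally_compact_hausdorff X)
  (X_pc : paracompact_hausdorff X)
  (Y_zd : has_clopen_base Y) (Y_lc : locally_compact_hausdorff Y)
  (Y_pc : paracompact_hausdorff Y) :
  order_isomorphic (@TK_le X) (@TK_le Y) <->
  homeomorphic (sigma_remainder R X) (sigma_remainder R Y).
Proof.
have base Z : has_clopen_base Z -> locally_compact_hausdorff Z ->
    paracompact_hausdorff Z -> compact_open_base (sigma_remainder R Z).
  move=> Z_zd Z_lc Z_pc z N /(remainder_trace_base Z_zd Z_lc Z_pc)[A [clA sA Az AN]].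
  exists (@remainder_trace R _ A); split=> //; first exact: compact_remainder_trace.
  exact: open_remainder_trace.
rewrite -(stone_duality (@sigma_remainder_hausdorff R X)
  (@sigma_remainder_hausdorff R Y) (base X _ _ _) (base Y _ _ _)) //.
have [phi [psi [phiK psiK le]]] := TK_dual R X_zd X_lc X_pc.
have [phi' [psi' [phiK' psiK' le']]] := TK_dual R Y_zd Y_lc Y_pc.
exact: (order_isomorphic_transfer phiK psiK phiK' psiK' le le').
Qed.
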